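(* Let $\mathcal C$ be a small category. For every $\mathcal C$-space $\mathbb X$, the endpoint evaluation map $\pi_{\mathbb X}\colon\mathbb X^{\mathbb I}\to\mathbb X\times\mathbb X$ has the homotopy lifting property.
   Context: $\mathrm{Top}$ is the category of compactly generated topological spaces; products and mapping spaces are taken in compactly generated spaces (mapping spaces with the compactly generated compact-open topology). A $\mathcal C$-space is a functor $\mathbb X\colon\mathcal C\to\mathrm{Top}$; a $\mathcal C$-map is a natural transformation. Products are objectwise; a space $K$ is also regarded as a constant $\mathcal C$-space; $\mathbb I=[0,1]$. The path $\mathcal C$-space $\mathbb X^{\mathbb I}$ is given by $\mathbb X^{\mathbb I}(c)=\mathrm{Hom}_{\mathrm{Top}}(\mathbb I,\mathbb X(c))$, $\mathbb X^{\mathbb I}(\alpha)(\gamma)=\mathbb X(\alpha)\circ\gamma$, and $\pi_{\mathbb X}$ is given objectwise by $\pi_{\mathbb X,c}(\gamma)=(\gamma(0),\gamma(1))$. A $\mathcal C$-map $p\colon\mathbb E\to\mathbb B$ has the homotopy lifting property if for every $\mathcal C$-space $\mathbb Y$ and all $\mathcal C$-maps $f\colon\mathbb Y\to\mathbb E$, $H\colon\mathbb Y\times\mathbb I\to\mathbb B$ with $H\circ i_0=p\circ f$ (where $i_0(c)(y)=(y,0)$) there is a $\mathcal C$-map $\widetilde H\colon\mathbb Y\times\mathbb I\to\mathbb E$ with $p\circ\widetilde H=H$ and $\widetilde H\circ i_0=f$. *)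

(* Defs.v *)
From HB Require Import structures.
From mathcomp Require Import all_boot all_order all_algebra.
From mathcomp Require Import all_classical all_reals all_analysis.
Import Order.TTheory GRing.Theory Num.Theory.
Import numFieldNormedType.Exports.

Set Implicit Arguments.
Unset Strict Implicit.
Unset Printing Implicit Defensive.

Local Open Scope classical_set_scope.
Local Open Scope ring_scope.

(* A is open as far as maps from compact Hausdorff spaces can detect. *)
Definition k_open (T : topologicalType) (A : set T) : Prop :=
  forall (K : topologicalType) (u : K -> T),
    compact [set: K] -> hausdorff_space K -> continuous u -> open (u @^-1` A).

(* No separation axiom is imposed on T. *)
HB.mixin Record isCompactlyGenerated T & Topological T := {
  k_open_open : forall A : set T, k_open A -> open A
}.

#[short(type="cgType")]
HB.structure Definition CompactlyGenerated :=
  {T of Topological T & isCompactlyGenerated T}.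

(* T with the finest topology having the same continuous maps from compact
   Hausdorff spaces. *)
Definition kify (T : Type) : Type := T.

Section kify.
Context (T : topologicalType).

HB.instance Definition _ := Choice.copy (kify T) T.

Let opT : k_open [set: T].
Proof. by move=> K u _ _ _; rewrite preimage_setT; exact: openT. Qed.

Let opI : setI_closed (@k_open T).
Proof.
by move=> A B kA kB K u cK hK cu; rewrite preimage_setI; apply: openI; auto.
Qed.

Let op_bigU (I : Type) (f : I -> set T) :
  (forall i, k_open (f i)) -> k_open (\bigcup_i f i).
Proof.
move=> kf K u cK hK cu; rewrite preimage_bigcup.
by apply: bigcup_open => i _; exact: kf.
Qed.

HB.instance Definition _ := isOpenTopological.Build (kify T) opT opI op_bigU.

Lemma kify_openE (A : set (kify T)) : open A = k_open (A : set T).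
Proof. by []. Qed.

Lemma continuous_to_kify_test (K : topologicalType) (u : K -> T) :
  compact [set: K] -> hausdorff_space K -> continuous u ->
  continuous (u : K -> kify T).
Proof.
by move=> cK hK cu; apply/continuousP => A kA; exact: (kA K u cK hK cu).
Qed.

Let kify_cg (A : set (kify T)) : k_open A -> open A.
Proof.
move=> kA; rewrite kify_openE => K u cK hK cu; apply: (kA K u) => //.
exact: continuous_to_kify_test.
Qed.

HB.instance Definition _ := isCompactlyGenerated.Build (kify T) kify_cg.

Lemma continuous_from_kify : continuous (id : kify T -> T).
Proof.
apply/continuousP => A oA; rewrite kify_openE => K u _ _ /continuousP cu; exact: cu.
Qed.

Lemma continuous_to_kify (X : cgType) (f : X -> T) :
  continuous f -> continuous (f : X -> kify T).
Proof.
move=> cf; apply/continuousP => A; rewrite kify_openE => kA.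
apply: k_open_open => K u cK hK cu.
apply: (kA K (f \o u)) => // x.
by apply: continuous_comp; [exact: cu | exact: cf].
Qed.

End kify.

Definition unit_interval (R : realType) : Type :=
  set_type (`[0, 1]%classic : set R).

Section unit_interval.
Context (R : realType).
Local Notation I := (unit_interval R).

HB.instance Definition _ := Topological.copy I (set_type (`[0, 1]%classic : set R)).

Lemma unit_interval_compact : compact [set: I].
Proof.
move=> F FF _.
have valF : (set_val @ F) (`[0, 1]%classic : set R).
  by rewrite /fmap/=; apply: (filterS _ filterT) => x _; exact: set_valP.
have [p [Ip clp]] := @segment_compact R 0 1 (set_val @ F) (fmap_proper_filter _ FF) valF.
exists (exist _ p (mem_set Ip)); split => // A B FA [_ [[W oW <-] Wp sB]].
have valA : (set_val @ F) (set_val @` A).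
  by rewrite /fmap/=; apply: (filterS _ FA) => x Ax; exists x.
have [_ [[x Ax <-] Wx]] := clp _ _ valA (open_nbhs_nbhs (conj oW Wp)).
by exists x; split => //; exact: sB.
Qed.

Lemma unit_interval_hausdorff : hausdorff_space I.
Proof.
move=> p q clpq; apply: val_inj; apply: (@Rhausdorff R) => A B pA qB.
have cv : continuous (set_val : I -> R) by exact: initial_continuous.
have [x [Ax Bx]] := clpq _ _ (cv p A pA) (cv q B qB).
by exists (set_val x).
Qed.

Let unit_interval_cg (A : set I) : k_open A -> open A.
Proof.
move=> /(_ I id unit_interval_compact unit_interval_hausdorff).
by apply => x; exact: cvg_id.
Qed.

HB.instance Definition _ := isCompactlyGenerated.Build I unit_interval_cg.

Lemma zero_in01 : (0 : R) \in (`[0, 1]%classic : set R).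
Proof. by rewrite inE /= in_itv /= lexx ler01. Qed.

Lemma one_in01 : (1 : R) \in (`[0, 1]%classic : set R).
Proof. by rewrite inE /= in_itv /= lexx ler01. Qed.

Definition I0 : I := exist _ 0 zero_in01.
Definition I1 : I := exist _ 1 one_in01.

End unit_interval.

(* Topologized as a subspace of the space of all functions with the
   compact-open topology. As I is Hausdorff, its compact subsets are the images
   of maps from compact Hausdorff spaces; kpath below k-ifies this topology. *)
Definition paths (R : realType) (X : topologicalType) : Type :=
  continuousType (unit_interval R) X.

HB.instance Definition _ (R : realType) (X : topologicalType) :=
  Topological.copy (paths R X)
    (@initial_topology (continuousType (unit_interval R) X)
       {compact-open, unit_interval R -> X} (fun g => g : _ -> _)).

Section paths.
Context (R : realType).
Local Notation I := (unit_interval R).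

Definition path_fun (X : topologicalType) (g : paths R X) : continuousType I X :=
  g.

Definition paths_postcomp (X Y : topologicalType) (f : continuousType X Y)
  (g : paths R X) : paths R Y := f \o path_fun g : continuousType I Y.

Lemma path_fun_continuous (X : topologicalType) :
  continuous (fun g : paths R X => path_fun g : {compact-open, I -> X}).
Proof. exact: initial_continuous. Qed.

Lemma paths_postcomp_continuous (X Y : topologicalType)
    (f : continuousType X Y) :
  continuous (paths_postcomp f).
Proof.
apply: continuous_comp_initial => g.
have Fg : Filter (nbhs g) by exact: nbhs_filter.
apply/(compact_open_cvgP _ (fmap_filter _ Fg)) => K O cK oO fgKO.
have oF : open (f @^-1` O) by apply: open_comp => // x _; exact: cts_fun.
have gKO : path_fun g @` K `<=` f @^-1` O.
  by move=> _ [t Kt <-]; apply: fgKO; exists t.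
have gn := @path_fun_continuous X g _
  (open_nbhs_nbhs (conj (compact_open_open cK oF) gKO)).
apply: (@filterS _ (nbhs g) _ _ _ _ gn) => h hKO _ [t Kt <-].
by apply: hKO; exists t.
Qed.

Lemma paths_eval_continuous (X : topologicalType) (t : I) :
  continuous (fun g : paths R X => path_fun g t).
Proof.
move=> g A; rewrite nbhsE => -[V [oV Vgt] VA].
have gV : path_fun g @` [set t] `<=` V by move=> _ [_ -> <-].
have gn := @path_fun_continuous X g _
  (open_nbhs_nbhs (conj (compact_open_open (@compact_set1 _ t) oV) gV)).
apply: (@filterS _ (nbhs g) _ _ _ _ gn) => h hV.
by apply: VA; apply: hV; exists t.
Qed.

End paths.

(* Products and path spaces in the category of compactly generated spaces. *)
Definition kprod (X Y : cgType) : cgType := kify (X * Y)%type.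

Definition kpath (R : realType) (X : cgType) : cgType := kify (paths R X).

Section kprod.

Lemma kfst_continuous (X Y : cgType) : continuous (fst : kprod X Y -> X).
Proof.
move=> z; apply: (continuous_comp (@continuous_from_kify (X * Y)%type z)).
exact: cvg_fst.
Qed.

Lemma ksnd_continuous (X Y : cgType) : continuous (snd : kprod X Y -> Y).
Proof.
move=> z; apply: (continuous_comp (@continuous_from_kify (X * Y)%type z)).
exact: cvg_snd.
Qed.

Lemma kpair_continuous (Z X Y : cgType) (f : Z -> X) (g : Z -> Y) :
  continuous f -> continuous g ->
  continuous ((fun z => (f z, g z)) : Z -> kprod X Y).
Proof.
by move=> cf cg; apply: continuous_to_kify => z; apply: cvg_pair; [exact: cf|exact: cg].
Qed.

Lemma kprod_map_continuous (X X' Y Y' : cgType) (f : continuousType X X')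
    (g : continuousType Y Y') :
  continuous ((fun z => (f z.1, g z.2)) : kprod X Y -> kprod X' Y').
Proof.
apply: kpair_continuous => z.
- by apply: (continuous_comp (@kfst_continuous X Y z)); exact: cts_fun.
- by apply: (continuous_comp (@ksnd_continuous X Y z)); exact: cts_fun.
Qed.

Definition kpair (Z X Y : cgType) (f : continuousType Z X)
    (g : continuousType Z Y) : continuousType Z (kprod X Y) :=
  mkcts (kpair_continuous (@cts_fun _ _ f) (@cts_fun _ _ g)).

Definition kprod_map (X X' Y Y' : cgType) (f : continuousType X X')
    (g : continuousType Y Y') : continuousType (kprod X Y) (kprod X' Y') :=
  mkcts (@kprod_map_continuous X X' Y Y' f g).

End kprod.

Section kpath.
Context (R : realType).

Lemma kpath_map_continuous (X Y : cgType) (f : continuousType X Y) :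
  continuous (paths_postcomp f : kpath R X -> kpath R Y).
Proof.
apply: continuous_to_kify => z.
exact: (@continuous_comp (kify (paths R X)) (paths R X) (paths R Y) id
  (paths_postcomp f) z (@continuous_from_kify _ z)
  (@paths_postcomp_continuous R X Y f z)).
Qed.

Lemma kpath_eval_continuous (X : cgType) (t : unit_interval R) :
  continuous ((fun g => path_fun g t) : kpath R X -> X).
Proof.
move=> z; exact: (@continuous_comp (kify (paths R X)) (paths R X) X id
  (fun g => path_fun g t) z (@continuous_from_kify _ z)
  (@paths_eval_continuous R X t z)).
Qed.

Definition kpath_map (X Y : cgType) (f : continuousType X Y) :
    continuousType (kpath R X) (kpath R Y) :=
  mkcts (@kpath_map_continuous X Y f).

Definition kpath_eval (X : cgType) (t : unit_interval R) :
    continuousType (kpath R X) X :=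
  mkcts (@kpath_eval_continuous X t).

End kpath.

(* The objects form a type, so smallness holds up to universe level. *)
Record smallCategory := SmallCategory {
  ob :> Type;
  mor : ob -> ob -> Type;
  idm : forall a, mor a a;
  compm : forall a b c, mor b c -> mor a b -> mor a c;
  compm_idl : forall a b (f : mor a b), compm (idm b) f = f;
  compm_idr : forall a b (f : mor a b), compm f (idm a) = f;
  compmA : forall a b c d (h : mor c d) (g : mor b c) (f : mor a b),
    compm h (compm g f) = compm (compm h g) f
}.

Record cspace (C : smallCategory) := CSpace {
  cs_ob :> C -> cgType;
  cs_map : forall a b : C, mor a b -> continuousType (cs_ob a) (cs_ob b);
  cs_map_id : forall (a : C) (x : cs_ob a), cs_map (idm a) x = x;
  cs_map_comp : forall (a b c : C) (g : mor b c) (f : mor a b) (x : cs_ob a),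
    cs_map (compm g f) x = cs_map g (cs_map f x)
}.

Record cmap (C : smallCategory) (X Y : cspace C) := CMap {
  cm_at :> forall c : C, continuousType (X c) (Y c);
  cm_nat : forall (a b : C) (f : mor a b) (x : X a),
    cm_at b (cs_map X f x) = cs_map Y f (cm_at a x)
}.

Section cspaces.
Context (C : smallCategory).

Lemma cmap_eqP (X Y : cspace C) (p q : cmap X Y) :
  p = q <-> forall c, p c =1 q c.
Proof.
split=> [->//|]; case: p q => [p pn] [q qn] /= pq.
have {}pq : p = q by apply: functional_extensionality_dep => c; apply/continuousEP; exact: pq.
by case: _ / pq qn => qn; rewrite (Prop_irrelevance pn qn).
Qed.

Lemma cmap_comp_nat (X Y Z : cspace C) (q : cmap Y Z) (p : cmap X Y)
    (a b : C) (f : mor a b) (x : X a) :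
  (q b \o p b) (cs_map X f x) = cs_map Z f ((q a \o p a) x).
Proof. by rewrite /= !cm_nat. Qed.

Definition cmap_comp (X Y Z : cspace C) (q : cmap Y Z) (p : cmap X Y) :
  cmap X Z :=
  CMap (cm_at := fun c => q c \o p c : continuousType _ _)
    (cmap_comp_nat q p).

Section cs_prod.
Context (X Y : cspace C).

Let prod_map (a b : C) (f : mor a b) := kprod_map (cs_map X f) (cs_map Y f).

Let prod_map_id (a : C) x : prod_map (idm a) x = x.
Proof. by case: x => x y; congr pair; exact: cs_map_id. Qed.

Let prod_map_comp (a b c : C) (g : mor b c) (f : mor a b) x :
  prod_map (compm g f) x = prod_map g (prod_map f x).
Proof. by case: x => x y; congr pair; exact: cs_map_comp. Qed.

Definition cs_prod : cspace C := CSpace prod_map_id prod_map_comp.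

End cs_prod.

Section cs_const.
Context (K : cgType).

Let const_map (a b : C) (_ : mor a b) : continuousType K K := idfun.

Definition cs_const : cspace C :=
  @CSpace C (fun=> K) const_map (fun _ _ => erefl) (fun _ _ _ _ _ _ => erefl).

End cs_const.

Section cs_path.
Context (R : realType) (X : cspace C).

Let path_map (a b : C) (f : mor a b) := kpath_map R (cs_map X f).

Let path_map_id (a : C) g : path_map (idm a) g = g.
Proof. by apply/continuousEP => t; exact: cs_map_id. Qed.

Let path_map_comp (a b c : C) (g : mor b c) (f : mor a b) h :
  path_map (compm g f) h = path_map g (path_map f h).
Proof. by apply/continuousEP => t; exact: cs_map_comp. Qed.

Definition cs_path : cspace C := CSpace path_map_id path_map_comp.

Let endpoints_at (c : C) :=
  kpair (kpath_eval (X c) (I0 R)) (kpath_eval (X c) (I1 R)).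

Let endpoints_nat (a b : C) (f : mor a b) g :
  endpoints_at b (cs_map cs_path f g) =
  cs_map (cs_prod X X) f (endpoints_at a g).
Proof. by []. Qed.

Definition endpoints : cmap cs_path (cs_prod X X) :=
  @CMap C cs_path (cs_prod X X) endpoints_at endpoints_nat.

End cs_path.

Section i0.
Context (R : realType) (Y : cspace C).

Let i0_at (c : C) : continuousType (Y c) (kprod (Y c) (unit_interval R)) :=
  kpair idfun (cst (I0 R)).

Let i0_nat (a b : C) (f : mor a b) y :
  i0_at b (cs_map Y f y) =
  cs_map (cs_prod Y (cs_const (unit_interval R))) f (i0_at a y).
Proof. by []. Qed.

Definition i0 : cmap Y (cs_prod Y (cs_const (unit_interval R))) :=
  @CMap C Y (cs_prod Y (cs_const (unit_interval R))) i0_at i0_nat.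

End i0.

Definition homotopy_lifting_property (R : realType) (E B : cspace C)
    (p : cmap E B) : Prop :=
  forall (Y : cspace C) (f : cmap Y E)
    (H : cmap (cs_prod Y (cs_const (unit_interval R))) B),
    cmap_comp H (i0 R Y) = cmap_comp p f ->
    exists Ht : cmap (cs_prod Y (cs_const (unit_interval R))) E,
      cmap_comp p Ht = H /\ cmap_comp Ht (i0 R Y) = f.

End cspaces.

(* Main.v *)
Require Import Defs.
From HB Require Import structures.
From mathcomp Require Import all_boot all_order all_algebra.
From mathcomp Require Import all_classical all_reals all_analysis.
From mathcomp Require Import ring lra.
Import Order.TTheory GRing.Theory Num.Theory.
Import numFieldNormedType.Exports.

Set Implicit Arguments.
Unset Strict Implicit.
Unset Printing Implicit Defensive.

Local Open Scope classical_set_scope.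
Local Open Scope ring_scope.

(** A homotopy H : Y * I -> X * X starting at the endpoints of the paths f(y)
    provides, for each (y, s), three paths that fit together: H_1(y, -) run
    backwards from time s to time 0, then f(y), then H_2(y, -) from time 0 to
    time s.  Giving the outer pieces length s and the middle one length 1 turns
    their concatenation into a path on [-s, 1 + s], namely the restriction to
    that interval of [extended_path], which depends on y only.  The lift sends
    (y, s) to this path, rescaled affinely to [0, 1] by [stretch].  Its endpoints
    are H_1(y, s) and H_2(y, s), and for s = 0 the rescaling is the identity, so
    that f(y) itself comes out.  The formula uses nothing but the values of f
    and H, hence it commutes with all the structure maps of the diagrams
    ([extended_path_nat]); the problem is thereby reduced to a single space.

    What remains is continuity into the path space.  By the exponential law for
    compactly generated spaces ([transpose_continuous]) it suffices that
    (y, s, t) |-> lift (y, s) t is continuous.  This map is pasted from three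
    maps on closed pieces ([continuous_if_le]); the middle one is continuous
    because evaluation of paths is ([kprod_eval_continuous]). *)

(** * Topological preliminaries *)

Lemma hausdorff_prod (S T : topologicalType) :
  hausdorff_space S -> hausdorff_space T -> hausdorff_space (S * T)%type.
Proof.
move=> hS hT [a b] [c d] cl; congr pair; [apply: hS|apply: hT] => A B nA nB.
- have [[x y] [/= Ax Bx]] := cl (fst @^-1` A) (fst @^-1` B)
    (@cvg_fst _ _ (nbhs a) (nbhs b) _ _ nA)
    (@cvg_fst _ _ (nbhs c) (nbhs d) _ _ nB).
  by exists x.
- have [[x y] [/= Ay By]] := cl (snd @^-1` A) (snd @^-1` B)
    (@cvg_snd _ _ (nbhs a) (nbhs b) _ _ nA)
    (@cvg_snd _ _ (nbhs c) (nbhs d) _ _ nB).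
  by exists y.
Qed.

(** The pasting lemma for the two closed sets [u <= c] and [c <= u], which meet
    exactly where [u = c]. *)
Lemma continuous_if_le (R : realType) (S T : topologicalType) (u : S -> R)
    (c : R) (g h : S -> T) :
  continuous u -> continuous g -> continuous h ->
  (forall z, u z = c -> g z = h z) ->
  continuous (fun z => if u z <= c then g z else h z).
Proof.
move=> cu cg ch gh; apply/continuous_closedP => A cA.
have -> : (fun z => if u z <= c then g z else h z) @^-1` A =
    (u @^-1` [set x | x <= c] `&` g @^-1` A) `|`
    (u @^-1` [set x | x >= c] `&` h @^-1` A).
  apply/seteqP; split=> z /=.
    by case: (leP (u z) c) => [|/ltW] uz Az; [left|right].
  case=> -[uz Az]; first by rewrite uz.
  by case: (leP (u z) c) => // zu; rewrite gh //; apply: le_anti; rewrite zu.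
by apply: closedU; apply: closedI; move: cu cg ch => /continuous_closedP cu
  /continuous_closedP cg /continuous_closedP ch; auto using closed_le, closed_ge.
Qed.

(** * The exponential law for path spaces *)

Section exponential.
Context (R : realType).
Local Notation I := (unit_interval R).

Lemma unit_interval_locally_compact : locally_compact [set: I].
Proof.
move=> t _; rewrite withinET; exists setT; first exact: filterT.
by split; [exact: unit_interval_compact|exact: closedT].
Qed.

(** Evaluation is already continuous for the compact-open topology and the
    usual product, because the interval is compact Hausdorff; both k-ifications
    on the source only refine its topology. *)
Lemma kprod_eval_continuous (X : cgType) :
  continuous ((fun z => path_fun z.1 z.2) : kprod (kpath R X) I -> X).
Proof.
have cev : continuous ((fun z => path_fun z.1 z.2) : paths R X * I -> X).
  have -> : (fun z : paths R X * I => path_fun z.1 z.2) =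
      uncurry (fun g : paths R X => path_fun g : I -> X) by apply/funext => -[].
  apply: continuous_uncurry; [exact: unit_interval_locally_compact|
    exact: unit_interval_hausdorff|exact: path_fun_continuous|].
  by move=> g; exact: cts_fun.
have cfst : continuous ((fun z => z.1) : kprod (kpath R X) I -> paths R X).
  move=> z; exact: (@continuous_comp (kprod (kpath R X) I) (kpath R X)
    (paths R X) fst id z (@kfst_continuous (kpath R X) I z)
    (@continuous_from_kify (paths R X) _)).
move=> z; exact: (@continuous_comp (kprod (kpath R X) I)
  (paths R X * I)%type X (fun w => (w.1 : paths R X, w.2)) _ z
  (cvg_pair (cfst z) (@ksnd_continuous (kpath R X) I z)) (cev _)).
Qed.

Lemma slice_continuous (Z X : cgType) (F : continuousType (kprod Z I) X)
    (z : Z) :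
  continuous ((fun t => F (z, t)) : I -> X).
Proof.
move=> t; apply: (@continuous_comp _ (kprod Z I) X (fun t => (z, t)) F).
  by apply: kpair_continuous => w; [exact: cst_continuous|exact: cvg_id].
exact: cts_fun.
Qed.

Definition transpose (Z X : cgType) (F : continuousType (kprod Z I) X) (z : Z) :
  kpath R X := mkcts (@slice_continuous Z X F z).

(** Continuity on [Z] may be tested along a map [u] from a compact Hausdorff
    space [K].  There [K * I] is again compact Hausdorff, so that the usual
    product maps continuously to the k-ified one, and ordinary currying
    applies. *)
Lemma transpose_continuous (Z X : cgType) (F : continuousType (kprod Z I) X) :
  continuous (transpose F).
Proof.
apply: (@continuous_to_kify (paths R X)).
apply/continuousP => A oA; apply: k_open_open => K u cK hK cu.
have cuI : continuous ((fun w => (u w.1, w.2)) : K * I -> kprod Z I).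
  apply: continuous_to_kify_test.
  - rewrite -setXTT; apply: compact_setX => //; exact: unit_interval_compact.
  - exact: hausdorff_prod hK (@unit_interval_hausdorff R).
  - have cu1 : continuous (fun w : K * I => u w.1).
      by move=> w; apply: (@continuous_comp _ K Z fst u); [exact: cvg_fst|exact: cu].
    by move=> w; exact: (cvg_pair (cu1 w) (@cvg_snd K I (nbhs w.1) (nbhs w.2) _)).
have cFu : continuous (fun w : K * I => F (u w.1, w.2)).
  move=> w; apply: (continuous_comp (@cuI w)); exact: cts_fun.
have cTu : continuous (transpose F \o u : K -> paths R X).
  apply: continuous_comp_initial; exact: continuous_curry_fun cFu.
by move/continuousP : cTu; exact.
Qed.

End exponential.

(** * Retracting the line onto the interval *)

Section clamp.
Context (R : realType).
Local Notation I := (unit_interval R).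

Lemma clamp_in01 (x : R) :
  Num.max 0 (Num.min 1 x) \in (`[0, 1]%classic : set R).
Proof. by rewrite inE /= in_itv /= le_max lexx /= ge_max ler01 ge_min lexx. Qed.

Definition clamp (x : R) : I := exist _ (Num.max 0 (Num.min 1 x)) (clamp_in01 x).

Lemma clamp_continuous : continuous clamp.
Proof.
apply: continuous_comp_initial => x.
have cmin : {for x, continuous (fun x : R => Num.min 1 x : R^o)}.
  exact: (@continuous_min R R (cst 1) id x (@cst_continuous _ _ _ _) cvg_id).
exact: (@continuous_max R R (cst 0) _ x (@cst_continuous _ _ _ _) cmin).
Qed.

Lemma val_continuous : continuous (val : I -> R).
Proof. exact: initial_continuous. Qed.

Lemma valK_clamp (t : I) : clamp (val t) = t.
Proof.
apply: val_inj => /=; have := set_valP t; rewrite /= in_itv /= => /andP[t0 t1].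
by rewrite min_r // max_r.
Qed.

Lemma clamp_le0 (x : R) : x <= 0 -> clamp x = I0 R.
Proof. by move=> x0; apply: val_inj => /=; rewrite max_l // ge_min x0 orbT. Qed.

Lemma clamp_ge1 (x : R) : 1 <= x -> clamp x = I1 R.
Proof. by move=> x1; apply: val_inj => /=; rewrite min_l // max_r. Qed.

End clamp.

(** * Lifting for a single space *)

Section lift.
Context (R : realType) (A X : cgType).
Local Notation I := (unit_interval R).
Context (f : continuousType A (kpath R X))
  (H : continuousType (kprod A I) (kprod X X)).
Hypothesis H_start : forall a,
  H (a, I0 R) = (path_fun (f a) (I0 R), path_fun (f a) (I1 R)).

(** As [t] runs through [0, 1], this runs affinely through [-s, 1 + s]. *)
Definition stretch (s t : I) : R := (1 + 2 * val s) * val t - val s.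

(** [f a] prolonged to the whole line by the two components of [H]; clamping
    makes the prolongation constant outside [-1, 2], and total. *)
Definition extended_path (a : A) (u : R) : X :=
  if u <= 0 then (H (a, clamp (- u))).1
  else if u <= 1 then path_fun (f a) (clamp u)
  else (H (a, clamp (u - 1))).2.

Let P := kprod (kprod A I) I.

Let base (z : P) : A := z.1.1.

Let base_continuous : continuous base.
Proof.
move=> z; exact: (@continuous_comp P (kprod A I) A fst fst z
  (@kfst_continuous (kprod A I) I z) (@kfst_continuous A I _)).
Qed.

Let param (z : P) : R := stretch z.1.2 z.2.

Let param_continuous : continuous param.
Proof.
have cs : continuous ((fun z => val z.1.2) : P -> R).
  have c1 : continuous ((fun z => z.1.2) : P -> I).
    move=> z; exact: (@continuous_comp P (kprod A I) I fst snd z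
      (@kfst_continuous (kprod A I) I z) (@ksnd_continuous A I _)).
  move=> z; exact: (@continuous_comp P I R _ _ z (c1 z) (@val_continuous R _)).
have ct : continuous ((fun z => val z.2) : P -> R).
  move=> z; exact: (@continuous_comp P I R snd _ z
    (@ksnd_continuous (kprod A I) I z) (@val_continuous R _)).
have c1s : continuous ((fun z => 1 + 2 * val z.1.2) : P -> R).
  move=> z; exact: (@cvgD R R^o P _ _ _ _ 1 _ (@cvg_cst _ _ _ _ _)
    (@cvgM R P _ _ _ _ 2 _ (@cvg_cst _ _ _ _ _) (cs z))).
move=> z; exact: (@cvgB R R^o P _ _ _ _ _ _
  (@cvgM R P _ _ _ _ _ _ (c1s z) (ct z)) (cs z)).
Qed.

Let clamp_pair_continuous (v : P -> R) : continuous v ->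
  continuous ((fun z => (base z, clamp (v z))) : P -> kprod A I).
Proof.
move=> cv; apply: kpair_continuous => z; first exact: base_continuous.
exact: (@continuous_comp P R I v _ z (cv z) (@clamp_continuous R _)).
Qed.

Let H_clamp_continuous (v : P -> R) : continuous v ->
  continuous ((fun z => H (base z, clamp (v z))) : P -> kprod X X).
Proof.
move=> cv z; exact: (@continuous_comp P (kprod A I) (kprod X X) _ H z
  (clamp_pair_continuous cv (x := z)) (@cts_fun _ _ H _)).
Qed.

Let lift_continuous : continuous (fun z => extended_path (base z) (param z)).
Proof.
have cH1 : continuous (fun z => (H (base z, clamp (- param z))).1).
  move=> z; apply: (@continuous_comp P (kprod X X) X _ fst z _
    (@kfst_continuous X X _)).
  apply: (@H_clamp_continuous (fun z => - param z)) => {}z.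
  exact: (@cvgN R R^o _ _ _ _ _ (@param_continuous z)).
have cH2 : continuous (fun z => (H (base z, clamp (param z - 1))).2).
  move=> z; apply: (@continuous_comp P (kprod X X) X _ snd z _
    (@ksnd_continuous X X _)).
  apply: (@H_clamp_continuous (fun z => param z - 1)) => {}z.
  exact: (@cvgB R R^o P _ _ _ _ _ 1 (@param_continuous z) (@cvg_cst _ _ _ _ _)).
have cf : continuous (fun z => path_fun (f (base z)) (clamp (param z))).
  have cfc : continuous ((fun z => (f (base z), clamp (param z))) :
      P -> kprod (kpath R X) I).
    apply: kpair_continuous => z.
      exact: (@continuous_comp P A (kpath R X) _ f z
        (@base_continuous z) (@cts_fun _ _ f _)).
    exact: (@continuous_comp P R I _ _ z (@param_continuous z)
      (@clamp_continuous R _)).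
  move=> z; exact: (@continuous_comp P (kprod (kpath R X) I) X _ _ z (cfc z)
    (@kprod_eval_continuous R X _)).
(* The pieces agree at u = 0 and at u = 1 because [H] starts at the endpoints
   of [f]. *)
apply: continuous_if_le => //; last first.
  move=> z ->; rewrite ler01 oppr0 !clamp_le0 // H_start //.
apply: continuous_if_le => // z ->.
by rewrite subrr clamp_ge1 // clamp_le0 // H_start.
Qed.

Definition path_lift (z : kprod A I) : kpath R X :=
  transpose (mkcts lift_continuous) z.

Lemma path_lift_continuous : continuous path_lift.
Proof. exact: transpose_continuous. Qed.

Lemma path_liftE (a : A) (s t : I) :
  path_fun (path_lift (a, s)) t = extended_path a (stretch s t).
Proof. by []. Qed.

Lemma extended_path_le0 (a : A) (u : R) :
  u <= 0 -> extended_path a u = (H (a, clamp (- u))).1.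
Proof. by rewrite /extended_path => ->. Qed.

Lemma extended_path_ge1 (a : A) (u : R) :
  1 <= u -> extended_path a u = (H (a, clamp (u - 1))).2.
Proof.
rewrite /extended_path => u1.
rewrite ifN; last by rewrite -ltNge (lt_le_trans ltr01).
case: leP => // u1'; have -> : u = 1 by apply: le_anti; rewrite u1 u1'.
by rewrite subrr clamp_ge1 // clamp_le0 // H_start.
Qed.

Lemma extended_path01 (a : A) (t : I) :
  extended_path a (val t) = path_fun (f a) t.
Proof.
have := set_valP t; rewrite /= in_itv /= => /andP[t0 t1].
rewrite /extended_path t1 valK_clamp; case: leP => // t0'.
have -> : t = I0 R by apply: val_inj; apply: le_anti; rewrite t0'.
by rewrite clamp_le0 ?oppr0 ?H_start.
Qed.

Lemma path_lift_endpoints (z : kprod A I) :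
  (path_fun (path_lift z) (I0 R), path_fun (path_lift z) (I1 R)) = H z.
Proof.
case: z => a s; have := set_valP s; rewrite /= in_itv /= => /andP[s0 s1].
rewrite !path_liftE [stretch s (I0 R)]/stretch [stretch s (I1 R)]/stretch /=.
rewrite mulr0 mulr1 add0r extended_path_le0 ?oppr_le0 //.
rewrite extended_path_ge1; last by lra.
have -> : 1 + 2 * val s - val s - 1 = val s by ring.
by rewrite opprK valK_clamp; case: (H _).
Qed.

Lemma path_lift_start (a : A) : path_lift (a, I0 R) = f a.
Proof.
apply/continuousEP => t; rewrite -[RHS]extended_path01.
by rewrite -[LHS]/(path_fun _ t) path_liftE /stretch /= mulr0 addr0 mul1r subr0.
Qed.

End lift.

(** * Naturality and the theorem *)

(** The case distinctions depend on [u] alone, so each piece can be compared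
    with its counterpart. *)
Lemma extended_path_nat (R : realType) (A A' X X' : cgType)
    (f : continuousType A (kpath R X))
    (H : continuousType (kprod A (unit_interval R)) (kprod X X))
    (f' : continuousType A' (kpath R X'))
    (H' : continuousType (kprod A' (unit_interval R)) (kprod X' X'))
    (phi : continuousType A A') (psi : continuousType X X') :
  (forall a, f' (phi a) = kpath_map R psi (f a)) ->
  (forall a s, H' (phi a, s) = kprod_map psi psi (H (a, s))) ->
  forall a u, extended_path f' H' (phi a) u = psi (extended_path f H a u).
Proof.
move=> f_nat H_nat a u; rewrite /extended_path f_nat !H_nat.
by case: ifP => // _; case: ifP.
Qed.

Theorem proposition5p6 (R : realType) (C : smallCategory) (X : cspace C) :
  homotopy_lifting_property R (endpoints R X).
Proof.
move=> Y f H /cmap_eqP Hf.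
have Hs c y : H c (y, I0 R) =
  (path_fun (f c y) (I0 R), path_fun (f c y) (I1 R)) by exact: Hf.
pose L c := mkcts (@path_lift_continuous R (Y c) (X c) (f c) (H c) (Hs c)) :
  continuousType (kprod (Y c) (unit_interval R)) (kpath R (X c)).
have Lnat (a b : C) (g : mor a b)
    (z : cs_prod Y (cs_const C (unit_interval R)) a) :
  L b (cs_map (cs_prod Y (cs_const C (unit_interval R))) g z) =
  cs_map (cs_path R X) g (L a z).
  case: z => y s; apply/continuousEP => t.
  apply: (@extended_path_nat _ _ _ _ _ _ _ _ _ (cs_map Y g) (cs_map X g)).
  - exact: (cm_nat f g).
  - by move=> y' s'; exact: (cm_nat H g (y', s')).
exists (@CMap C (cs_prod Y (cs_const C (unit_interval R)))
  (cs_path R X) L Lnat); split; apply/cmap_eqP => c z.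
- exact: path_lift_endpoints.
- exact: path_lift_start.
Qed.
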